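(* For $n\ge0$ let $p^{(n)}_{\mathcal T}(x)=\sum_{j=1}^{n+1}\mathcal T_{n,j}x^{j-1}$ and $q^{(n)}(x)=p^{(n)}_{\mathcal T}(x)-(x+1)^n$ for $x\in\mathbb R$. Then: (1) $q^{(n)}=0$ for $n\in\{0,1,2,3\}$; (2) for every $n\ge4$, $q^{(n)}$ has degree $n-1$ and its coefficients sum to zero. Accordingly, $q^{(n)}$ has a root at $x=1$ for every $n\ge 0$.
   Context: Define $\psi:\{1,2,3,\dots\}\to\{0,1,2,\dots\}$ by $\psi(1)=0$, $\psi(2)=1$, $\psi(3)=2$ and $\psi(j)=\sum_{k=1}^{j-1}\psi(k)$ for $j\ge 4$. The triangular array $\mathcal T=(\mathcal T_{n,j})$, $n\ge 0$, $1\le j\le n+1$, of integers is defined recursively by: $\mathcal T_{n,n+1}=1$ for every $n\ge 0$; $\mathcal T_{1,1}=1$, $\mathcal T_{2,2}=2$, $\mathcal T_{3,3}=3$; $\mathcal T_{n,n}=\sum_{k=1}^{n-2}\mathcal T_{n-k,n-k}$ for every $n\ge 4$; and $\mathcal T_{n,j}=\mathcal T_{n-1,j}+\psi(j)$ for every $n\ge 2$ and $1\le j\le n-1$. *)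

(* Defs.v *)
From HB Require Import structures.
From mathcomp Require Import all_boot all_order all_algebra.
From mathcomp Require Import reals zify.

Set Implicit Arguments.
Unset Strict Implicit.
Unset Printing Implicit Defensive.

Import Order.TTheory GRing.Theory Num.Theory.
Local Open Scope ring_scope.

(* Course-of-values recursions are run on the list of all earlier values; the
   defining recurrences are recovered as the lemmas that follow each function. *)

(* [psi_seq n = [:: psi 1; ...; psi n]] *)
Fixpoint psi_seq (n : nat) : seq nat :=
  if n is m.+1 then
    let s := psi_seq m in
    rcons s (match m with 0 => 0 | 1 => 1 | 2 => 2 | _ => sumn s end)%N
  else [::].

(* [psi 0 = 0] is a junk value: indices start at 1. *)
Definition psi (j : nat) : nat := last 0%N (psi_seq j).

Lemma psi_seqE n : psi_seq n = [seq psi k | k <- iota 1 n].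
Proof.
elim: n => [//|n IHn].
by rewrite -[in iota _ _](addn1 n) iotaD map_cat -IHn /= cats1 /psi /= last_rcons.
Qed.

Lemma psi1 : psi 1 = 0%N. Proof. by []. Qed.
Lemma psi2 : psi 2 = 1%N. Proof. by []. Qed.
Lemma psi3 : psi 3 = 2%N. Proof. by []. Qed.

Lemma psi_rec j : (4 <= j)%N -> psi j = (\sum_(1 <= k < j) psi k)%N.
Proof.
case: j => [|[|[|[|j]]]] // _.
have -> : psi j.+4 = sumn (psi_seq j.+3) by rewrite {1}/psi [LHS]last_rcons.
by rewrite psi_seqE sumnE big_map /index_iota subn1.
Qed.

(* [diag_seq n = [:: T_{1,1}; ...; T_{n,n}]]; [behead] removes [T_{1,1}], which
   does not enter the sum [T_{n-1,n-1} + ... + T_{2,2}]. *)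
Fixpoint diag_seq (n : nat) : seq int :=
  if n is m.+1 then
    let s := diag_seq m in
    rcons s (match m with
             | 0 => 1 | 1 => 2%:Z | 2 => 3%:Z
             | _ => \sum_(x <- behead s) x
             end)
  else [::].

Definition diag (n : nat) : int := last 0 (diag_seq n).

(* The entry in row [n] and column [j]; it is meaningful only for
   [1 <= j <= n.+1]. *)
Fixpoint T (n j : nat) : int :=
  if j == n.+1 then 1
  else if j == n then diag n
  else if n is m.+1 then T m j + (psi j)%:Z
  else 0.

Lemma T_last n : T n n.+1 = 1.
Proof. by case: n => [//|n] /=; rewrite eqxx. Qed.

Lemma T_diag n : T n n = diag n.
Proof. by case: n => [//|n] /=; rewrite eqxx ltn_eqF. Qed.

Lemma T11 : T 1 1 = 1. Proof. by []. Qed.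
Lemma T22 : T 2 2 = 2. Proof. by []. Qed.
Lemma T33 : T 3 3 = 3. Proof. by []. Qed.

Lemma diag_seqE n : diag_seq n = [seq diag k | k <- iota 1 n].
Proof.
elim: n => [//|n IHn].
by rewrite -[in iota _ _](addn1 n) iotaD map_cat -IHn /= cats1 /diag /= last_rcons.
Qed.

Lemma T_diag_rec n : (4 <= n)%N ->
  T n n = \sum_(1 <= k < n.-1) T (n - k) (n - k).
Proof.
case: n => [|[|[|[|n]]]] // _; rewrite T_diag.
have -> : diag n.+4 = \sum_(x <- behead (diag_seq n.+3)) x.
  by rewrite {1}/diag [LHS]last_rcons.
rewrite diag_seqE [behead _]/= -[diag 2 :: _]/[seq diag k | k <- iota 2 n.+2].
rewrite big_map.
rewrite -[iota 2 _]/(index_iota 2 n.+4) big_nat_rev big_add1 /=.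
by apply: eq_big_nat => k _; rewrite T_diag; congr diag; lia.
Qed.

Lemma T_rec n j : (2 <= n)%N -> (1 <= j <= n.-1)%N ->
  T n j = T n.-1 j + (psi j)%:Z.
Proof.
case: n => [//|n] _ /andP[_ le_jn] /=.
by rewrite !ltn_eqF // ltnS (leq_trans le_jn).
Qed.

Definition pT (R : realType) (n : nat) : {poly R} :=
  \sum_(1 <= j < n.+2) (T n j)%:~R *: 'X^(j.-1).

Definition q (R : realType) (n : nat) : {poly R} := pT R n - ('X + 1) ^+ n.

(* Main.v *)
Require Import Defs.
From HB Require Import structures.
From mathcomp Require Import all_boot all_order all_algebra.
From mathcomp Require Import reals.
From mathcomp Require Import zify.

(** The first four rows are those of Pascal's triangle; later rows keep its
    row sums.  From index 4 on, [psi] is the sum of all its earlier values, so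
    that each further step doubles it; the diagonal [T n n] doubles for the
    same reason, its sum leaving out only [T 1 1].  Hence
    [psi n = 3 * 2 ^ (n - 4)] and [T n n = 5 * 2 ^ (n - 4)] for [4 <= n].
    For such [n], passing from row [n - 1] to row [n] keeps the final entry 1,
    inserts [T n n], and adds [psi 1, ..., psi (n - 1)] to the other entries; the
    latter increments add up to [psi n].  The row sum therefore grows by
    [(5 + 3) * 2 ^ (n - 4) = 2 ^ (n - 1)], and since it is [2 ^ 3] for row 3
    it is [2 ^ n] for every row, the value of [(x + 1) ^ n] at [x = 1].  Hence
    [q] vanishes at 1, and its value there is the sum of its coefficients.

    For the degree, the leading terms cancel because [T n n.+1 = 1], and the
    next coefficient is [5 * 2 ^ (n - 4) - n], which is positive. *)

Set Implicit Arguments.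
Unset Strict Implicit.
Unset Printing Implicit Defensive.

Import Order.TTheory GRing.Theory Num.Theory.
Local Open Scope ring_scope.

Lemma psiE m : psi m.+4 = (3 * 2 ^ m)%N.
Proof.
elim: m => [|m IHm]; first by [].
rewrite psi_rec // big_nat_recr //= -psi_rec // IHm expnS; lia.
Qed.

Lemma sum_psi n : (3 <= n)%N -> (\sum_(1 <= k < n.+1) psi k = psi n.+1)%N.
Proof. by move=> n_ge3; rewrite psi_rec. Qed.

Lemma T_diagE m : T m.+4 m.+4 = 5%:Z * 2 ^+ m.
Proof.
elim: m => [|m IHm]; first by rewrite T_diag_rec // unlock.
rewrite T_diag_rec // succnK big_ltn // subn1 succnK.
rewrite big_add1 succnK.
(* The shifted tail of the recurrence is the recurrence of the previous row. *)
have -> : \sum_(1 <= k < m.+3) T (m.+4.+1 - k.+1) (m.+4.+1 - k.+1) = T m.+4 m.+4.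
  by rewrite T_diag_rec //; apply: eq_bigr => k _; rewrite subSS.
by rewrite IHm exprS; lia.
Qed.

(** The recurrence of the array acts only on the first [n] columns; the last
    entry 1 moves one column to the right and leaves room for [T n.+1 n.+1]. *)
Lemma row_sum_rec n : (1 <= n)%N ->
  \sum_(1 <= j < n.+3) T n.+1 j =
  \sum_(1 <= j < n.+2) T n j + T n.+1 n.+1 + (\sum_(1 <= j < n.+1) psi j)%N%:Z.
Proof.
move=> n_ge1.
have recr (F : nat -> int) k :
    \sum_(1 <= j < k.+2) F j = \sum_(1 <= j < k.+1) F j + F k.+1.
  by rewrite big_nat_recr.
rewrite (recr _ n.+1) !(recr _ n) !T_last.
have -> : \sum_(1 <= j < n.+1) T n.+1 j =
          \sum_(1 <= j < n.+1) T n j + (\sum_(1 <= j < n.+1) psi j)%N%:Z.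
  rewrite (big_morph Posz PoszD (erefl _)) -big_split.
  by apply: eq_big_nat => j j_lt; rewrite T_rec.
lia.
Qed.

Lemma row_sum n : \sum_(1 <= j < n.+2) T n j = 2 ^+ n.
Proof.
case: n => [|[|[|n]]]; try by rewrite unlock.
elim: n => [|n IHn]; first by rewrite unlock.
rewrite row_sum_rec // IHn T_diagE sum_psi // psiE !exprS PoszM.
rewrite -[Posz (2 ^ n)]natz natrX.
lia.
Qed.

Lemma q_poly (R : realType) n :
  q R n = \poly_(i < n.+1) (T n i.+1 - 'C(n, i)%:Z)%:~R.
Proof.
rewrite /q /pT big_add1 big_mkord [in RHS]poly_def addrC exprD1n.
under [in RHS]eq_bigr => i _ do rewrite rmorphB scalerBl.
rewrite sumrB addrC; congr (_ - _).
by apply: eq_bigr => i _; rewrite scaler_nat.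
Qed.

(** Both top coefficients are 1, so the degree drops below [n]; [size] can then
    be read off the coefficient of index [n - 1]. *)
Lemma q_poly_trim (R : realType) n :
  q R n = \poly_(i < n) (T n i.+1 - 'C(n, i)%:Z)%:~R.
Proof.
by rewrite q_poly !poly_def big_ord_recr /= T_last binn subrr scale0r addr0.
Qed.

Lemma horner_q1 (R : realType) n : (q R n).[1] = 0.
Proof.
rewrite /q /pT !hornerE horner_sum.
under eq_bigr => j _ do rewrite !hornerE expr1n mulr1.
by rewrite -rmorph_sum /= row_sum rmorphXn /= subrr.
Qed.

Theorem corollary2p13 (R : realType) :
  (forall n : nat, (n <= 3)%N -> q R n = 0) /\
  (forall n : nat, (4 <= n)%N ->
     size (q R n) = (n - 1).+1%N /\
     \sum_(i < size (q R n)) (q R n)`_i = 0) /\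
  (forall n : nat, root (q R n) 1).
Proof.
split=> [n n_le3|].
  rewrite q_poly_trim; apply/polyP => i; rewrite coef_poly coef0.
  by case: n i n_le3 => [|[|[|[|]]]] // [|[|[|]]].
split=> [n n_ge4|n]; last by rewrite rootE horner_q1.
split; last first.
  rewrite -[RHS](horner_q1 R n) horner_coef.
  by apply: eq_bigr => i _; rewrite expr1n mulr1.
case: n n_ge4 => [|[|[|[|m]]]] // _.
rewrite subn1 q_poly_trim size_poly_eq // intr_eq0 T_diagE binSn.
rewrite -natrX natz; have := ltn_expl m (leqnn 2); lia.
Qed.
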